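(* Let $m,n$ be positive integers with $d=m-n>0$. The only possible real solutions $z$ of $S(m,n,z)=S(m,n)$ are $z=0$ and $z=n$. Moreover, if $d>2$, there exists $z\in\mathbb{C}\setminus\mathbb{R}$ satisfying $S(m,n,z)=S(m,n)$.
   Context: $S(m,n)$ denotes the Stirling number of the second kind. For positive integers $m,n$, with $d=m-n$, and $z\in\mathbb{C}$, the Stirling function is $$S(m,n,z)=\frac{(-1)^{d}}{n!}\sum_{k=0}^{n}\binom{n}{k}(-1)^{k}(z-k)^{m}.$$ *)

(* Defs.v *)
From mathcomp Require Import all_boot all_order all_algebra.
From mathcomp Require Import reals complex.

Set Implicit Arguments.
Unset Strict Implicit.
Unset Printing Implicit Defensive.

Import Order.TTheory GRing.Theory Num.Theory.
Local Open Scope ring_scope.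
Local Open Scope complex_scope.

(* Stirling number of the second kind: the number of partitions of an
   m-element set into n blocks (partition requires the blocks to be nonempty). *)
Definition stirling2 (m n : nat) : nat :=
  #|[set P : {set {set 'I_m}} | partition P [set: 'I_m] && (#|P| == n)]|.

(* The exponent d = m - n is an integer, possibly negative. *)
Definition stirling_fun (R : realType) (m n : nat) (z : R[i]) : R[i] :=
  (-1) ^ (m%:Z - n%:Z) / (n`!)%:R *
  \sum_(0 <= k < n.+1) ('C(n, k))%:R * (-1) ^+ k * (z - k%:R) ^+ m.

(* Main.v *)
Require Import Defs.
From mathcomp Require Import all_boot all_order all_algebra separable.
From mathcomp Require Import reals complex.
From mathcomp Require Import ring.

(** Up to the nonzero factor (-1)^d / n!, the Stirling function is the n-th
    backward difference of the monomial X^m.  Recentred at its axis of symmetry,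
    w = z - n/2, it becomes the n-th central difference q (of step 1) of X^m
    ([stirling_fun_cdiff]).  A central difference kills the even part of the
    Taylor increment and doubles the odd part, so it sends a polynomial of degree
    d + 1 with nonnegative coefficients, all in degrees of the parity of d + 1, to
    a polynomial of degree d with the same two properties
    ([parity_nneg_cdiff]); hence q is such a polynomial, of degree d = m - n.

    Such a q satisfies |q(x)| = q(|x|) on the real line, by parity, and is
    strictly increasing on the nonnegative half-line, by positivity.  So
    q(x) = q(y) forces |x| = |y| ([parity_nneg_eq]).  Now S(m,n) is the value of
    the Stirling function at z = 0 ([stirling_fun0]), that is, at w = - n/2; a
    real solution therefore has w = n/2 or w = - n/2, which is z = n or z = 0.

    The derivative of q is again of the same kind, so it does not vanish at
    w = n/2 or w = - n/2, and these two points are at most simple roots of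
    q - q(- n/2).  As soon as d > 2 this polynomial must have a complex root
    elsewhere ([simple_roots_escape]), and that root cannot be real.

    The identity S(m,n,0) = S(m,n) is the classical formula for the Stirling
    numbers.  It comes from counting the surjections from an m-set to an n-set in
    two ways: each partition into n blocks is the fibre partition of n! of them
    ([card_surj_partition]), and inclusion-exclusion over the missed values gives
    the alternating sum ([card_surj]). *)

Set Implicit Arguments.
Unset Strict Implicit.

Import Order.TTheory GRing.Theory Num.Theory.
Local Open Scope ring_scope.
Local Open Scope complex_scope.

(** * Surjections and set partitions *)

(** Between sets of the same cardinality, injections are automatically onto, so
    the falling-factorial count of injections applies. *)
Lemma card_inj_ffuns_onto (T I : finType) (P : {set T}) : #|P| = #|I| ->
  #|[set g : {ffun I -> T} | injectiveb g & g @: I == P]| = #|I|`!.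
Proof.
move=> cardP; rewrite -ffactnn -{1}cardP -(card_inj_ffuns_on I (mem P)).
apply: eq_card => g; rewrite !inE andbC.
apply/andP/andP => [[/eqP <- inj_g]|[/ffun_onP gP inj_g]]; split=> //.
  by apply/ffun_onP => i; apply: imset_f.
rewrite eqEcard; apply/andP; split.
  by apply/subsetP => _ /imsetP[i _ ->]; apply: gP.
by rewrite cardP card_imset //; apply/injectiveP.
Qed.

Definition fibers (T I : finType) (f : {ffun T -> I}) : {ffun I -> {set T}} :=
  [ffun i => f @^-1: [set i]].

Lemma fibersP (T I : finType) (f : {ffun T -> I}) i x :
  (x \in fibers f i) = (f x == i).
Proof. by rewrite ffunE !inE. Qed.

Lemma fibers_inj (T I : finType) : injective (@fibers T I).
Proof.
move=> f f' eq_ff'; apply/ffunP => x; apply/eqP.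
by rewrite -fibersP eq_ff' fibersP.
Qed.

(** A surjection is the same thing as a partition of its source whose blocks are
    labelled bijectively by its target. *)
Lemma fibers_surj (T I : finType) :
  @fibers T I @: [set f : {ffun T -> I} | f @: T == setT] =
  [set g : {ffun I -> {set T}} | injectiveb g & partition (g @: I) setT].
Proof.
apply/setP => g; apply/imsetP/idP => [[f]|].
  rewrite inE => /eqP surj_f ->; rewrite inE.
  have hit i : exists x, f x = i.
    have: i \in f @: T by rewrite surj_f inE.
    by case/imsetP => x _ ->; exists x.
  apply/andP; split.
    apply/injectiveP => i j eq_ij; have [x fx] := hit i.
    by apply/eqP; rewrite -fx -fibersP -eq_ij fibersP fx.
  apply/and3P; split.
  - apply/eqP/setP => x; rewrite inE; apply/bigcupP.
    by exists (fibers f (f x)); rewrite ?imset_f ?fibersP.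
  - apply/trivIsetP => _ _ /imsetP[i _ ->] /imsetP[j _ ->] neq_ij.
    rewrite -setI_eq0; apply/eqP/setP => x; rewrite inE !fibersP inE.
    by apply/andP => -[/eqP fi /eqP fj]; rewrite -fi -fj eqxx in neq_ij.
  - apply/imsetP => -[i _ /setP eq0]; have [x fx] := hit i.
    by have:= eq0 x; rewrite fibersP fx eqxx inE.
rewrite inE => /andP[/injectiveP inj_g /and3P[/eqP cov /trivIsetP triv n0]].
(* Conversely, every point lies in exactly one labelled block; send it to the label. *)
have ex_i x : exists i, x \in g i.
  have: x \in cover (g @: I) by rewrite cov inE.
  by case/bigcupP => _ /imsetP[i _ ->]; exists i.
pose f := [ffun x => xchoose (ex_i x)].
have fE x i : (x \in g i) = (f x == i).
  rewrite ffunE; apply/idP/eqP => [xi|<-]; last exact: xchooseP (ex_i x).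
  apply: inj_g; apply/eqP/idPn => neq.
  have:= triv _ _ (imset_f g _) (imset_f g _) neq => /(_ isT isT).
  by move=> dis; have:= disjointFl dis xi; rewrite (xchooseP (ex_i x)).
exists f; last by apply/ffunP => i; apply/setP => x; rewrite fibersP fE.
rewrite inE; apply/eqP/setP => i; rewrite inE.
have: g i != set0 by apply: contra n0 => /eqP <-; apply: imset_f.
case/set0Pn => x; rewrite fE => /eqP <-; exact: imset_f.
Qed.

(** Grouping the surjections by their fibre partition: each partition with the
    right number of blocks arises once for every labelling of its blocks. *)
Lemma card_surj_partition (T I : finType) :
  #|[set f : {ffun T -> I} | f @: T == setT]| =
  (#|[set P : {set {set T}} | partition P setT && (#|P| == #|I|)]| * #|I|`!)%N.
Proof.
rewrite -(card_imset _ (@fibers_inj T I)) fibers_surj -sum1_card.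
rewrite (partition_big (fun g : {ffun I -> {set T}} => g @: I)
  (mem [set P : {set {set T}} | partition P setT && (#|P| == #|I|)])) /=; last first.
  move=> g; rewrite !inE => /andP[/injectiveP inj_g ->] /=.
  by rewrite card_imset.
rewrite -sum_nat_const; apply: eq_bigr => P; rewrite inE => /andP[partP /eqP cP].
rewrite -(card_inj_ffuns_onto cP) -sum1_card; apply: eq_bigl => g.
by rewrite !inE -andbA; case: eqP => [->|]; rewrite ?partP ?andbF.
Qed.

Lemma sum_set_card (V : nmodType) (I : finType) (F : nat -> V) :
  \sum_(J : {set I}) F #|J| = \sum_(k < #|I|.+1) F k *+ 'C(#|I|, k).
Proof.
rewrite (partition_big (fun J : {set I} => inord #|J| : 'I_#|I|.+1) xpredT) //=.
apply: eq_bigr => k _; rewrite -card_draws -sumr_const.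
apply: eq_big => [J|J /eqP <-]; rewrite ?inordK ?ltnS ?max_card //.
by rewrite inE -(inj_eq val_inj) /= inordK ?ltnS ?max_card.
Qed.

(** Inclusion-exclusion.  A map f is onto iff the product over i of
    1 - [i is missed by f] is 1; expanding this product gives a signed sum over
    the sets J of values that f avoids, and the maps avoiding J are the maps into
    the complement of J. *)
Lemma card_surj (R : comNzRingType) (T I : finType) :
  #|[set f : {ffun T -> I} | f @: T == setT]|%:R =
  \sum_(k < #|I|.+1) (-1) ^+ k * (#|I| - k)%:R ^+ #|T| *+ 'C(#|I|, k) :> R.
Proof.
rewrite -(@sum_set_card R I (fun k => (-1) ^+ k * (#|I| - k)%:R ^+ #|T|)).
pose avoids (f : {ffun T -> I}) (J : {set I}) := [forall x, f x \in ~: J].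
transitivity (\sum_(f : {ffun T -> I}) \sum_(J : {set I})
    (-1) ^+ #|J| * (avoids f J)%:R : R).
  rewrite -sum1_card natr_sum big_mkcond; apply: eq_bigr => f _ /=.
  transitivity (\prod_(i : I) (- (i \notin f @: T)%:R + 1) : R).
    rewrite inE; case: eqP => [->|/eqP].
      by rewrite big1 // => i _; rewrite inE oppr0 add0r.
    rewrite -subTset => /subsetPn[i _ fi].
    by rewrite (bigD1 i) //= fi addNr mul0r.
  rewrite bigA_distr; apply: eq_bigr => J _.
  rewrite -big_mkcond /= prodrN; congr (_ * _).
  rewrite -natr_prod; congr _%:R.
  have [/forallP av|/forallPn[x]] := boolP (avoids f J).
    rewrite big1 // => i iJ; rewrite (_ : _ \notin _) //.
    by apply/imsetP => -[x _ ix]; have:= av x; rewrite inE -ix iJ.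
  rewrite inE negbK => fxJ.
  by rewrite (bigD1 (f x)) //= imset_f.
rewrite exchange_big; apply: eq_bigr => J _ /=.
rewrite -mulr_sumr; congr (_ * _).
rewrite (_ : #|I| - #|J| = #|~: J|)%N; last by rewrite [RHS]cardsCs setCK.
rewrite -natrX -card_ffun_on -natr_sum -sum1_card [in RHS]big_mkcond /=.
by congr _%:R; apply: eq_bigr => f _; rewrite inE -/(avoids _ _); case: avoids.
Qed.

Lemma stirling2_sum (R : comNzRingType) (m n : nat) :
  (stirling2 m n * n`!)%:R =
  \sum_(k < n.+1) (-1) ^+ k * (n - k)%:R ^+ m *+ 'C(n, k) :> R.
Proof.
have:= card_surj R 'I_m 'I_n.
by rewrite card_surj_partition !card_ord.
Qed.

(** * Iterated central differences *)

Definition cdiff (R : comNzRingType) (h : R) (p : {poly R}) : {poly R} :=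
  (p \Po ('X + h%:P)) - (p \Po ('X - h%:P)).

Lemma horner_cdiff (R : comNzRingType) (h : R) (p : {poly R}) x :
  (cdiff h p).[x] = p.[x + h] - p.[x - h].
Proof. by rewrite /cdiff hornerD hornerN !horner_comp !hornerE. Qed.

Lemma horner_iter_cdiff (R : comNzRingType) (h : R) (p : {poly R}) n x :
  (iter n (cdiff h) p).[x] =
  \sum_(k < n.+1) 'C(n, k)%:R * (-1) ^+ k * p.[x + h *+ n - h *+ k.*2].
Proof.
elim: n x => [|n IHn] x.
  by rewrite big_ord1 bin0 expr0 !mul1r !mulr0n addr0 subr0.
rewrite iterS horner_cdiff !IHn [RHS]big_ord_recl.
under [in RHS]eq_bigr => k _ do rewrite binS natrD !mulrDl.
rewrite big_split /= addrA; congr (_ + _).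
  rewrite [X in _ = _ + X]big_ord_recr /= (@bin_small n n.+1) // !mul0r addr0.
  rewrite [in LHS]big_ord_recl !bin0 !subr0.
  congr (_ * _.[_] + _); first by rewrite [h *+ n.+1]mulrS addrA.
  apply: eq_bigr => k _; congr (_ * _.[_]).
  by rewrite [h *+ n.+1]mulrS addrA.
rewrite -sumrN; apply: eq_bigr => k _.
rewrite /bump /= add1n exprS mulN1r mulrN mulNr; congr (- (_ * _.[_])).
by rewrite doubleS [h *+ n.+1]mulrS 2!mulrS !opprD !addrA [x + h + _]addrAC addrK [x - h + _]addrAC.
Qed.

Lemma map_iter_cdiff (R S : comNzRingType) (f : {rmorphism R -> S}) h p n :
  map_poly f (iter n (cdiff h) p) = iter n (cdiff (f h)) (map_poly f p).
Proof.
elim: n => //= n <-; rewrite /cdiff rmorphB /= !map_comp_poly.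
by rewrite rmorphD rmorphB /= map_polyX map_polyC.
Qed.

Lemma coef_exp_XaddC (R : comNzRingType) (c : R) i j :
  (('X + c%:P) ^+ i)`_j = c ^+ (i - j) *+ 'C(i, j).
Proof.
rewrite addrC exprDn coef_sum.
have [ji|ij] := ltnP j i.+1; last first.
  rewrite bin_small // mulr0n big1 // => k _.
  rewrite coefMn -rmorphXn /= coefCM coefXn gtn_eqF ?mulr0 ?mul0rn //.
  exact: leq_trans (ltn_ord k) ij.
rewrite (bigD1 (Ordinal ji)) //= big1 ?addr0.
  by rewrite coefMn -rmorphXn /= coefCM coefXn eqxx mulr1.
move=> k; rewrite -(inj_eq val_inj) /= eq_sym => /negPf kj.
by rewrite coefMn -rmorphXn /= coefCM coefXn kj mulr0 mul0rn.
Qed.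

(** By Taylor's formula the k-th order terms in +h and -h cancel for k even and
    add up for k odd, whence the factor 2 * [odd (i - j)]. *)
Lemma coef_cdiff (R : comNzRingType) (h : R) (p : {poly R}) j :
  (cdiff h p)`_j =
  \sum_(i < size p) p`_i * (h ^+ (i - j) *+ ((odd (i - j)).*2 * 'C(i, j))).
Proof.
rewrite coefB !coef_comp_poly -sumrB; apply: eq_bigr => i _.
rewrite -mulrBr -polyCN !coef_exp_XaddC -mulrnBl exprNn -signr_odd mulrnA.
by case: odd; rewrite /= ?expr1 ?expr0 ?mulN1r ?mul1r ?opprK ?subrr ?mulr2n.
Qed.

(** * Polynomials with nonnegative coefficients and a parity *)

Definition parity_nneg (R : numDomainType) (d : nat) (p : {poly R}) : Prop :=
  [/\ size p = d.+1, forall i, 0 <= p`_i &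
      forall i, odd i != odd d -> p`_i = 0].

Lemma parity_nneg_Xn (R : numDomainType) d : @parity_nneg R d 'X^d.
Proof.
split=> [|i|i]; rewrite ?size_polyXn // coefXn; first exact: ler0n.
by case: (i =P d) => [->|//]; rewrite eqxx.
Qed.

Lemma parity_nneg_lead (R : numDomainType) d (p : {poly R}) :
  parity_nneg d p -> 0 < p`_d.
Proof.
case=> sz p_ge0 _; rewrite lt_def p_ge0 andbT.
by have:= lead_coef_eq0 p; rewrite lead_coefE sz -size_poly_eq0 sz => ->.
Qed.

Lemma size_poly_top (R : numDomainType) d (p : {poly R}) :
  (forall i, (d < i)%N -> p`_i = 0) -> 0 < p`_d -> size p = d.+1.
Proof.
move=> p0 pd; apply/eqP; rewrite eqn_leq; apply/andP; split.
  by apply/leq_sizeP => i /p0.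
by rewrite ltnNge; apply/negP => /leq_sizeP/(_ d (leqnn d)) p_d; rewrite p_d ltxx in pd.
Qed.

(** The coefficient formula has only nonnegative terms, so no cancellation can
    occur; the top coefficient d comes from the leading one, p_(d+1), with the
    positive factor 2 h (d + 1). *)
Lemma parity_nneg_cdiff (R : numDomainType) (h : R) d (p : {poly R}) : 0 < h ->
  parity_nneg d.+1 p -> parity_nneg d (cdiff h p).
Proof.
move=> h_gt0 Kp; have [sz p_ge0 p_par] := Kp.
have term_ge0 i j : 0 <= p`_i * (h ^+ (i - j) *+ ((odd (i - j)).*2 * 'C(i, j))).
  by rewrite mulr_ge0 // mulrn_wge0 // exprn_ge0 // ltW.
split=> [|j|j par_j]; last 2 first.
- by rewrite coef_cdiff; apply: sumr_ge0 => i _; apply: term_ge0.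
- rewrite coef_cdiff big1 // => i _.
  have [par_i|/p_par->] := eqVneq (odd i) (odd d.+1); last by rewrite mul0r.
  have [ij|ji] := ltnP i j; first by rewrite bin_small // muln0 mulr0n mulr0.
  rewrite oddB // par_i /=.
  by move: par_j; do 2!case: odd; rewrite //= ?mulr0n ?mulr0.
apply: size_poly_top => [j dj|]; rewrite coef_cdiff sz.
  rewrite big1 // => i _; have: (i <= j)%N by rewrite (leq_trans _ dj) // -ltnS.
  by rewrite -subn_eq0 => /eqP->; rewrite mulr0n mulr0.
rewrite big_ord_recr /= ltr_wpDl ?sumr_ge0 //.
rewrite subSnn binSn mulr_gt0 ?(parity_nneg_lead Kp) //.
by rewrite pmulrn_lgt0 ?exprn_gt0.
Qed.

Lemma parity_nneg_iter_cdiff (R : numDomainType) (h : R) d n (p : {poly R}) : 0 < h ->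
  parity_nneg (n + d) p -> parity_nneg d (iter n (cdiff h) p).
Proof.
move=> h_gt0; elim: n d => //= n IHn d Kp; apply: parity_nneg_cdiff => //.
by apply: IHn; rewrite addnS.
Qed.

Lemma parity_nneg_deriv (R : numDomainType) d (p : {poly R}) :
  parity_nneg d.+1 p -> parity_nneg d p^`().
Proof.
move=> Kp; have [sz p_ge0 p_par] := Kp.
split=> [|j|j par_j]; last 2 first.
- by rewrite coef_deriv mulrn_wge0.
- by rewrite coef_deriv p_par ?mul0rn //=; move: par_j; do 2!case: odd.
apply: size_poly_top => [j dj|]; rewrite coef_deriv.
  by rewrite nth_default ?mul0rn // sz.
by rewrite pmulrn_lgt0 // (parity_nneg_lead Kp).
Qed.

Lemma parity_nneg_horner_gt0 (R : numDomainType) d (p : {poly R}) x :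
  parity_nneg d p -> 0 < x -> 0 < p.[x].
Proof.
move=> Kp x_gt0; have [sz p_ge0 _] := Kp.
rewrite horner_coef sz big_ord_recr /= ltr_wpDl //.
  by apply: sumr_ge0 => i _; rewrite mulr_ge0 // exprn_ge0 // ltW.
by rewrite mulr_gt0 ?exprn_gt0 // (parity_nneg_lead Kp).
Qed.

Lemma parity_nneg_mono (R : numDomainType) d (p : {poly R}) x y :
  parity_nneg d.+1 p -> 0 <= x -> x < y -> p.[x] < p.[y].
Proof.
move=> Kp x_ge0 xy; have [sz p_ge0 _] := Kp.
rewrite !horner_coef sz big_ord_recr [ltRHS]big_ord_recr /= ler_ltD //.
  apply: ler_sum => i _; rewrite ler_wpM2l // lerXn2r // ?nnegrE //.
    exact: le_trans x_ge0 (ltW xy).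
  exact: ltW.
rewrite ltr_pM2l ?(parity_nneg_lead Kp) // ltrXn2r //.
Qed.

(** By parity p(x) and p(-x) differ by the sign (-1)^d at most, and p is
    nonnegative on the nonnegative half-line.  This handles d even and d odd at
    once. *)
Lemma parity_nneg_normr (R : realDomainType) d (p : {poly R}) x :
  parity_nneg d p -> `|p.[x]| = p.[`|x|].
Proof.
move=> Kp; have [_ p_ge0 p_par] := Kp.
have pge0 y : 0 <= y -> 0 <= p.[y].
  by move=> y0; rewrite horner_coef sumr_ge0 // => i _; rewrite mulr_ge0 ?exprn_ge0.
have [x_ge0|x_lt0] := ger0P x; first by rewrite ger0_norm ?pge0.
have -> : p.[x] = (-1) ^+ d * p.[- x].
  rewrite !horner_coef mulr_sumr; apply: eq_bigr => i _.
  rewrite [(- x) ^+ i]exprNn mulrCA [(-1) ^+ d * _]mulrA -exprD.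
  have [par|/p_par->] := eqVneq (odd i) (odd d); last by rewrite !mul0r.
  by rewrite -[(-1) ^+ (d + i)]signr_odd oddD par addbb mul1r.
by rewrite normrMsign ger0_norm // pge0 // oppr_ge0 ltW.
Qed.

(** Taking absolute values reduces the claim to the nonnegative half-line, where p
    is strictly increasing. *)
Lemma parity_nneg_eq (R : realDomainType) d (p : {poly R}) x y :
  parity_nneg d.+1 p -> p.[x] = p.[y] -> `|x| = `|y|.
Proof.
move=> Kp eq_p; have {}eq_p : p.[`|x|] = p.[`|y|].
  by rewrite -!(parity_nneg_normr _ Kp) eq_p.
by case: (ltgtP `|x| `|y|) => // lt_xy;
  have := parity_nneg_mono Kp (normr_ge0 _) lt_xy; rewrite eq_p ltxx.
Qed.

(** Otherwise all roots of p would lie in s, hence be simple, and p would be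
    separable with at most [size s] roots, against its degree. *)
Lemma simple_roots_escape (F : closedFieldType) (p : {poly F}) (s : seq F) :
  (forall x, x \in s -> root p x -> p^`().[x] != 0) ->
  ((size s).+1 < size p)%N -> exists2 x, root p x & x \notin s.
Proof.
move=> simple_s lt_sp.
have p_neq0 : p != 0 by rewrite -size_poly_gt0 (leq_trans _ lt_sp).
have lc : lead_coef p != 0 by rewrite lead_coef_eq0.
have [r def_p] := closed_field_poly_normal p.
have root_r x : root p x = (x \in r) by rewrite def_p rootZ // root_prod_XsubC.
have [/hasP[x xr xs]|/hasPn r_s] := boolP (has [predC s] r).
  by exists x; rewrite ?root_r.
have {}r_s x : x \in r -> x \in s by move/r_s; rewrite /= negbK.
have uniq_r : uniq r.
  rewrite -separable_prod_XsubC -(eqp_separable (eqp_scale _ lc)) -def_p.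
  rewrite unlock; apply/Pdiv.ClosedField.coprimepP => x px.
  by apply: simple_s => //; apply: r_s; rewrite -root_r.
have := uniq_leq_size uniq_r r_s.
by rewrite leqNgt -ltnS -(size_prod_XsubC r id) -(size_scale _ lc) -def_p lt_sp.
Qed.

(** * The Stirling function as a central difference *)

(** At z = 0 the sum defining the Stirling function is, after reversing the
    order of summation, the inclusion-exclusion count of surjections; the sign
    (-1)^d turns (-1)^k (-1)^m into (-1)^(n-k). *)
Lemma stirling_fun0 (R : realType) (m n : nat) : (n <= m)%N ->
  stirling_fun m n (0 : R[i]) = (stirling2 m n)%:R.
Proof.
move=> le_nm.
have nf0 : (n`!)%:R != 0 :> R[i] by rewrite pnatr_eq0 -lt0n fact_gt0.
rewrite /stirling_fun mulrAC; apply: (canLR (mulfK nf0)).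
rewrite -natrM stirling2_sum subzn // -exprnP big_mkord mulr_sumr.
rewrite [RHS](reindex_inj rev_ord_inj); apply: eq_bigr => k _ /=.
have le_kn : (k <= n)%N by rewrite -ltnS.
rewrite subSS subKn // bin_sub // sub0r [(- k%:R) ^+ m]exprNn.
have -> : (-1) ^+ (n - k) = (-1) ^+ (m - n) * (-1) ^+ k * (-1) ^+ m :> R[i].
  rewrite -!exprD -signr_odd -[RHS]signr_odd !oddD !oddB //.
  by do 3!case: odd.
rewrite -[RHS]mulr_natr.
by move: ((-1) ^+ (m - n)) ((-1) ^+ k) ((-1) ^+ m) (k%:R ^+ m) => A B C D; ring.
Qed.

(** The nodes z - k, 0 <= k <= n, are symmetric about z - n/2: from this centre
    z - k is reached by n - k steps of +1/2 and k steps of -1/2. *)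
Lemma stirling_fun_cdiff (R : realType) (m n : nat) (z : R[i]) :
  stirling_fun m n z = (-1) ^ (m%:Z - n%:Z) / (n`!)%:R *
    (iter n (cdiff 2^-1) 'X^m).[z - n%:R / 2].
Proof.
rewrite horner_iter_cdiff /stirling_fun big_mkord; congr (_ * _).
apply: eq_bigr => k _; rewrite hornerXn; congr (_ * _ ^+ _).
by rewrite mulr_natl subrK -mul2n mulrnA -[_ *+ 2]mulr_natr mulVf ?pnatr_eq0.
Qed.

(** The complex polynomial has real coefficients, so that order arguments apply to
    it. *)
Lemma cdiff_real (R : realType) (m n : nat) :
  iter n (cdiff 2^-1) 'X^m =
  map_poly (real_complex R) (iter n (cdiff 2^-1) 'X^m).
Proof. by rewrite map_iter_cdiff map_polyXn fmorphV rmorph_nat. Qed.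

Unset Implicit Arguments.
Set Strict Implicit.

(** * Real and nonreal solutions *)

Theorem corollary3 (R : realType) (m n : nat) (d : int)
    (hm : (0 < m)%N) (hn : (0 < n)%N) (hd : d = m%:Z - n%:Z) (hd0 : 0 < d) :
  (forall z : R[i], z \is Num.real ->
     stirling_fun m n z = (stirling2 m n)%:R -> z = 0 \/ z = n%:R) /\
  (2 < d ->
     exists z : R[i], z \isn't Num.real /\
       stirling_fun m n z = (stirling2 m n)%:R).
Proof.
have lt_nm : (n < m)%N by rewrite -ltz_nat -subr_gt0 -hd.
have [e def_m] : {e | m = (n + e.+1)%N}.
  by exists (m - n.+1)%N; rewrite addnS -addSn subnKC.
(* m = n + (e + 1), so d = e + 1, and q has degree d. *)
pose q : {poly R} := iter n (cdiff 2^-1) 'X^m.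
have Kq : parity_nneg e.+1 q.
  apply: parity_nneg_iter_cdiff; first by rewrite invr_gt0.
  by rewrite -def_m; apply: parity_nneg_Xn.
pose a : R := n%:R / 2.
have a_gt0 : 0 < a by rewrite divr_gt0 ?ltr0n.
have aC : a%:C = n%:R / 2 by rewrite rmorphM fmorphV !rmorph_nat.
pose qC := map_poly (real_complex R) q.
have qCE x : qC.[x%:C] = q.[x]%:C by apply: horner_map.
(* In the centred variable, the value S(m,n) is taken at - n/2, the image of z = 0. *)
have solE z : stirling_fun m n z = (stirling2 m n)%:R <->
    qC.[z - a%:C] = q.[- a]%:C.
  rewrite -(stirling_fun0 _ (ltnW lt_nm)) !stirling_fun_cdiff cdiff_real -/q.
  rewrite -/qC sub0r -aC -qCE rmorphN /=; split=> [|-> //].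
  apply: mulfI; rewrite mulf_neq0 ?invr_eq0 ?pnatr_eq0 -?lt0n ?fact_gt0 //.
  by rewrite expfz_neq0 // oppr_eq0 oner_eq0.
have real_sol (w : R[i]) : w \is Num.real -> qC.[w] = q.[- a]%:C ->
    w \in [:: - a%:C; a%:C].
  case/complex_realP => x ->; rewrite qCE => /complexI.
  move=> /(parity_nneg_eq Kq)/eqP; rewrite normrN (gtr0_norm a_gt0).
  rewrite eqr_norml ltW // andbT !inE -rmorphN /= !(inj_eq (@complexI R)).
  by rewrite orbC.
split=> [z z_real /solE /real_sol|d_gt2].
  rewrite realB // ?complex_real ?eqxx // => /(_ isT).
  rewrite !inE => /orP[]/eqP/(canRL (subrK _)) ->; [left|right].
    by rewrite addNr.
  by rewrite aC -splitr.
pose p := qC - (q.[- a]%:C)%:P.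
have [sz _ _] := Kq.
have sz_p : size p = e.+2.
  rewrite size_polyDl size_map_poly sz // size_polyN.
  exact: leq_ltn_trans (size_polyC_leq1 _) _.
have p_neq0 : p != 0 by rewrite -size_poly_eq0 sz_p.
have rootE w : root p w = (qC.[w] == q.[- a]%:C).
  by rewrite rootE hornerD hornerN hornerC subr_eq0.
have e_gt1 : (1 < e)%N.
  by move: d_gt2; rewrite hd def_m PoszD addrAC subrr add0r.
(* At - n/2 and n/2 the derivative of q is nonzero, having absolute value q'(n/2) > 0. *)
case: (@simple_roots_escape _ p [:: - a%:C; a%:C]) => [x|/=|w].
- rewrite !inE => x_a _.
  have [y -> y_a] : exists2 y, x = y%:C & `|y| = a.
    case/orP: x_a => /eqP ->; [exists (- a)|exists a]; rewrite ?rmorphN //=.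
      by rewrite normrN gtr0_norm.
    by rewrite gtr0_norm.
  rewrite derivB derivC subr0 deriv_map horner_map fmorph_eq0 -normr_gt0.
  rewrite (parity_nneg_normr _ (parity_nneg_deriv Kq)) y_a.
  exact: parity_nneg_horner_gt0 (parity_nneg_deriv Kq) a_gt0.
- by rewrite sz_p.
rewrite rootE => /eqP qw w_a; exists (w + a%:C); split; last first.
  by apply/solE; rewrite addrK.
apply: contra w_a => w_real; apply: real_sol qw.
by rewrite -(addrK a%:C w) realB // complex_real.
Qed.
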